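(* Let $n\ge 2$, let $\mathcal{A}$ be a commutative, finitely generated, unital $\mathbb{C}$-algebra, let $G$ be a finite group acting on $\mathcal{A}$ by algebra automorphisms, and let $\epsilon:\mathcal{A}\rtimes G\to\mathbb{C}$ be an algebra homomorphism (an augmentation). Let $\lambda\in\mathfrak{h}^*$ be a dominant integral weight of $\mathfrak{sl}_n$. Then there is an isomorphism of $\mathfrak{sl}_n(\mathcal{A}\rtimes G)$-modules $$W^{\epsilon}_{\mathcal{A}\rtimes G}(\lambda)\cong W^{\overline{\epsilon}}_{\overline{\mathcal{A}}}(\lambda).$$
   Context: All algebras are over $\mathbb{C}$. $\mathcal{A}\rtimes G$ is the smash product, with $(a_1g_1)(a_2g_2)=a_1g_1(a_2)g_1g_2$. For an associative algebra $R$, $\mathfrak{sl}_n(R)=[\mathfrak{gl}_n(R),\mathfrak{gl}_n(R)]$ with $\mathfrak{gl}_n(R)=\mathfrak{gl}_n\otimes R$; it contains $\mathfrak{sl}_n\otimes R$. $\mathfrak{h}$ is the diagonal Cartan subalgebra of $\mathfrak{sl}_n=\mathfrak{sl}_n(\mathbb{C})$, $\mathfrak{n}^+$ the strictly upper triangular matrices, and $P$ the weight lattice. Integrable: a module $M$ over $\mathfrak{sl}_n(R)$ is called integrable if it is the direct sum of its weight spaces $M_\mu$ for $\mathfrak{h}$ and $M_\mu$ is non-zero for only finitely many $\mu\in P$. Weyl module: $W^{\epsilon}_{\mathcal{A}\rtimes G}(\lambda)$ is the maximal integrable cyclic $\mathfrak{sl}_n(\mathcal{A}\rtimes G)$-module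 generated by a vector $v_\lambda$ such that, for all $a\in\mathcal{A}\rtimes G$ and $h\in\mathfrak{h}$, $(h\otimes a)v_\lambda=\lambda(h)\epsilon(a)v_\lambda$ and $(\mathfrak{n}^+\otimes(\mathcal{A}\rtimes G))v_\lambda=0$ (maximal: every integrable module generated by such a vector is a quotient of it by a map sending $v_\lambda$ to the generator). $W^{\overline\epsilon}_{\overline{\mathcal{A}}}(\lambda)$ is defined in the same way with $\mathcal{A}\rtimes G$ replaced by $\overline{\mathcal{A}}$ (trivial group) and $\epsilon$ by $\overline{\epsilon}$. The ring $\overline{\mathcal{A}}$: decompose $\mathcal{A}=\mathcal{A}^G\oplus\mathcal{A}'$ as $G$-modules, where $\mathcal{A}'$ is the subrepresentation without invariants; $\overline{\mathcal{A}}$ is the quotient of $\mathcal{A}$ by the ideal generated by $\mathcal{A}'$. Since $\mathcal{A}'\subset[\mathcal{A}\rtimes G,\mathcal{A}\rtimes G]$, $\epsilon$ vanishes on $\mathcal{A}'$ and its restriction to $\mathcal{A}$ descends to an augmentation $\overline{\epsilon}:\overline{\mathcal{A}}\to\mathbb{C}$. The Lie algebra $\mathfrak{sl}_n(\mathcal{A}\rtimes G)$ acts on $W^{\overline\epsilon}_{\overline{\mathcal{A}}}(\lambda)$ via the surjective algebra map $\mathcal{A}\rtimes G\to\overline{\mathcal{A}}$, $a g\mapsto \epsilon(g)\,\overline{a}$. *)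

(* Defs.v *)
From HB Require Import structures.
From mathcomp Require Import all_boot all_order all_algebra all_fingroup.
From mathcomp Require Import generic_quotient ring_quotient complex.
From mathcomp Require Import boolp reals.

Set Implicit Arguments.
Unset Strict Implicit.
Unset Printing Implicit Defensive.

Import GRing.Theory Num.Theory.

Local Open Scope ring_scope.
Local Open Scope quotient_scope.

HB.mixin Record Lmodule_isLie (K : fieldType) L of GRing.Lmodule K L := {
  lie : L -> L -> L;
  lie_linearl : forall y, linear (lie^~ y);
  lie_linearr : forall x, linear (lie x);
  liexx : forall x, lie x x = 0;
  lie_jacobi : forall x y z,
    lie x (lie y z) + lie y (lie z x) + lie z (lie x y) = 0
}.

#[short(type="lieAlgType")]
HB.structure Definition LieAlgebra (K : fieldType) :=
  {L of GRing.Lmodule K L & Lmodule_isLie K L}.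

Record lieModule (K : fieldType) (L : lieAlgType K) := LieModule {
  lm_sort :> lmodType K;
  lm_act : L -> lm_sort -> lm_sort;
  lm_act_linearl : forall v, linear (lm_act^~ v);
  lm_act_linearr : forall x, linear (lm_act x);
  lm_act_lie : forall x y v,
    lm_act (lie x y) v = lm_act x (lm_act y v) - lm_act y (lm_act x v)
}.

Section LieModules.
Variables (K : fieldType) (L : lieAlgType K).
Implicit Types M N : lieModule L.

Definition lie_equivariant M N (f : M -> N) : Prop :=
  forall x v, f (lm_act x v) = lm_act x (f v).

Definition lie_isomorphic M N : Prop :=
  exists f : {linear M -> N}, bijective f /\ lie_equivariant f.

Definition lie_submodule M (S : M -> Prop) : Prop :=
  [/\ S 0,
      forall (c : K) u v, S u -> S v -> S (c *: u + v) &
      forall x u, S u -> S (lm_act x u)].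

Definition generates M (v : M) : Prop :=
  forall S : M -> Prop, lie_submodule S -> S v -> forall u, S u.

End LieModules.

Fact jacobi_terms (V : zmodType) (a b c d e f : V) :
  (a - b + (d - c)) + (c - e + (b - f)) + (f - d + (e - a)) = 0.
Proof.
rewrite !addrA [LHS](ACl (((((1*12)*(2*7))*(3*10))*(4*5))*(6*11)*(8*9))).
by rewrite /= !subrr ?addNr !addr0.
Qed.

Section SpecialLinear.
Variables (K : fieldType) (n : nat) (R : algType K).
Implicit Types X Y Z : 'M[R]_n.

(* Sums of commutators form a K-subspace since c [X, Y] = [c X, Y]. *)
Definition sl_pred : {pred 'M[R]_n} := fun X =>
  `[< exists s : seq ('M[R]_n * 'M[R]_n),
        X = \sum_(p <- s) (p.1 *m p.2 - p.2 *m p.1) >].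

Lemma sl_comm X Y : X *m Y - Y *m X \in sl_pred.
Proof. by apply/asboolP; exists [:: (X, Y)]; rewrite big_seq1. Qed.

Lemma sl_predD X Y : X \in sl_pred -> Y \in sl_pred -> X + Y \in sl_pred.
Proof.
move=> /asboolP[s ->] /asboolP[t ->]; apply/asboolP.
by exists (s ++ t); rewrite big_cat.
Qed.

Lemma sl_pred0 : 0 \in sl_pred.
Proof. by apply/asboolP; exists [::]; rewrite big_nil. Qed.

Lemma sl_predN X : X \in sl_pred -> - X \in sl_pred.
Proof.
move=> /asboolP[s ->]; rewrite -sumrN.
elim: s => [|p s IHs]; first by rewrite big_nil sl_pred0.
by rewrite big_cons sl_predD // opprB sl_comm.
Qed.

Lemma sl_zmod_closed : zmod_closed sl_pred.
Proof. by split=> [|X Y sX sY]; [exact: sl_pred0 | rewrite sl_predD ?sl_predN]. Qed.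

HB.instance Definition _ := GRing.isZmodClosed.Build 'M[R]_n sl_pred sl_zmod_closed.

Lemma sl_predZ (c : K) X : X \in sl_pred -> (c%:A : R) *: X \in sl_pred.
Proof.
move=> /asboolP[s ->]; rewrite scaler_sumr.
elim: s => [|p s IHs]; first by rewrite big_nil sl_pred0.
rewrite big_cons sl_predD // scalerBr scalemxAl.
suff -> : (c%:A : R) *: (p.2 *m p.1) = p.2 *m ((c%:A : R) *: p.1) by exact: sl_comm.
apply/matrixP=> i j; rewrite !mxE mulr_sumr; apply: eq_bigr => k _.
by rewrite mxE !mulr_algl scalerAr.
Qed.

Record sl := Sl { sl_val :> 'M[R]_n; _ : sl_val \in sl_pred }.

HB.instance Definition _ := [isSub for sl_val].
HB.instance Definition _ := [Choice of sl by <:].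
HB.instance Definition _ := [SubChoice_isSubZmodule of sl by <:].

Lemma sl_valP (x : sl) : sl_val x \in sl_pred. Proof. exact: (valP x). Qed.

Definition sl_scale (c : K) (x : sl) : sl := Sl (sl_predZ c (sl_valP x)).

Fact sl_scaleA a b x : sl_scale a (sl_scale b x) = sl_scale (a * b) x.
Proof. by apply: val_inj; rewrite /= scalerA mulr_algl scalerA. Qed.
Fact sl_scale1 : left_id 1 sl_scale.
Proof. by move=> x; apply: val_inj; rewrite /= !scale1r. Qed.
Fact sl_scaleDr : right_distributive sl_scale +%R.
Proof. by move=> c x y; apply: val_inj; rewrite /= scalerDr. Qed.
Fact sl_scaleDl x : {morph sl_scale^~ x : a b / a + b}.
Proof. by move=> a b; apply: val_inj; rewrite /= !scalerDl. Qed.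

HB.instance Definition _ := GRing.Zmodule_isLmodule.Build K sl
  sl_scaleA sl_scale1 sl_scaleDr sl_scaleDl.

Definition sl_lie (x y : sl) : sl := Sl (sl_comm x y).

Fact sl_lie_linearl y : linear (sl_lie^~ y).
Proof.
move=> c x z; apply: val_inj => /=.
have commZ : y *m ((c%:A : R) *: (x : 'M[R]_n)) = (c%:A : R) *: (y *m x).
  apply/matrixP=> i j; rewrite !mxE mulr_sumr; apply: eq_bigr => k _.
  by rewrite mxE !mulr_algl scalerAr.
by rewrite mulmxDl mulmxDr commZ -scalemxAl scalerBr opprD addrACA.
Qed.

Fact sl_lie_anti x y : sl_lie x y = - sl_lie y x.
Proof. by apply: val_inj; rewrite /= opprB. Qed.

Fact sl_lie_linearr x : linear (sl_lie x).
Proof.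
move=> c y z; rewrite sl_lie_anti sl_lie_linearl opprD -scalerN.
by rewrite -!sl_lie_anti.
Qed.

Fact sl_liexx x : sl_lie x x = 0.
Proof. by apply: val_inj; rewrite /= subrr. Qed.

Fact sl_jacobi x y z :
  sl_lie x (sl_lie y z) + sl_lie y (sl_lie z x) + sl_lie z (sl_lie x y) = 0.
Proof.
apply: val_inj; case: x y z => [x _] [y _] [z _] /=.
rewrite !mulmxBl !mulmxBr !mulmxA !opprB.
exact: jacobi_terms.
Qed.

HB.instance Definition _ := Lmodule_isLie.Build K sl
  sl_lie_linearl sl_lie_linearr sl_liexx sl_jacobi.

End SpecialLinear.

Arguments sl {K} n R.

Section Tensor.
Variables (K : fieldType) (n : nat) (R : algType K).

(* x (x) a, under the identification gl_n (x) R = M_n(R). *)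
Lemma sl_tensor_subproof (x : sl n K^o) (a : R) :
  map_mx (fun c : K => c *: a) (x : 'M_n) \in @sl_pred K n R.
Proof.
case: x => x /= /asboolP[s ->].
have -> : map_mx (fun c : K => c *: a) (\sum_(p <- s) (p.1 *m p.2 - p.2 *m p.1))
  = \sum_(p <- s) map_mx (fun c : K => c *: a) (p.1 *m p.2 - p.2 *m p.1).
  apply/matrixP=> i j; rewrite mxE !summxE scaler_suml.
  by apply: eq_bigr => p _; rewrite [RHS]mxE.
apply: rpred_sum => p _.
pose y := map_mx (fun c : K => c%:A : R) p.1.
pose z := map_mx (fun c : K => c *: a) p.2.
suff -> : map_mx (fun c : K => c *: a) (p.1 *m p.2 - p.2 *m p.1)
  = y *m z - z *m y by exact: sl_comm.
apply/matrixP=> i j; rewrite !mxE scalerBl !scaler_suml.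
congr (_ - _); apply: eq_bigr => k _; rewrite !mxE.
  by rewrite mulr_algl scalerA.
by rewrite mulr_algr scalerA mulrC.
Qed.

Definition sl_tensor (x : sl n K^o) (a : R) : sl n R := Sl (sl_tensor_subproof x a).

End Tensor.

Section SlMap.
Variables (K : fieldType) (n : nat) (R S : algType K) (phi : {lrmorphism R -> S}).

Lemma sl_map_subproof (x : sl n R) : map_mx phi (x : 'M_n) \in @sl_pred K n S.
Proof.
case: x => x /= /asboolP[s ->]; rewrite raddf_sum.
apply: rpred_sum => p _.
by rewrite /= map_mxB !map_mxM sl_comm.
Qed.

Definition sl_map (x : sl n R) : sl n S := Sl (sl_map_subproof x).

Fact sl_map_linear : linear sl_map.
Proof.
move=> c x y; apply: val_inj; apply/matrixP=> i j /=.
by rewrite !mxE !mulr_algl linearP.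
Qed.

Fact sl_map_lie x y : sl_map (lie x y) = lie (sl_map x) (sl_map y).
Proof. by apply: val_inj; rewrite /= map_mxB !map_mxM. Qed.

Variable M : lieModule (sl n S).

Fact sl_restrict_linearl (v : M) : linear (fun x => lm_act (sl_map x) v).
Proof. by move=> c x y; rewrite sl_map_linear lm_act_linearl. Qed.

Fact sl_restrict_lie x y (v : M) :
  lm_act (sl_map (lie x y)) v =
  lm_act (sl_map x) (lm_act (sl_map y) v) - lm_act (sl_map y) (lm_act (sl_map x) v).
Proof. by rewrite sl_map_lie lm_act_lie. Qed.

Definition sl_restrict : lieModule (sl n R) :=
  LieModule sl_restrict_linearl (fun x => lm_act_linearr (sl_map x)) sl_restrict_lie.

End SlMap.

Section Cartan.
Variables (K : fieldType) (n : nat).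

Definition cartan_pred : {pred sl n K^o} := fun x => is_diag_mx (x : 'M_n).

Lemma cartan_submod_closed : submod_closed cartan_pred.
Proof.
split; first by apply/is_diag_mxP => i j _; rewrite mxE.
move=> c x y /is_diag_mxP dx /is_diag_mxP dy; apply/is_diag_mxP => i j ij.
by rewrite !mxE dx // dy // mulr0 addr0.
Qed.

HB.instance Definition _ := GRing.isSubmodClosed.Build K (sl n K^o) cartan_pred
  cartan_submod_closed.

Record cartan := Cartan { cartan_val :> sl n K^o; _ : cartan_val \in cartan_pred }.

HB.instance Definition _ := [isSub for cartan_val].
HB.instance Definition _ := [Choice of cartan by <:].
HB.instance Definition _ := [SubChoice_isSubLmodule of cartan by <:].

Lemma coroot_subproof (i j : 'I_n) :
  (delta_mx i i - delta_mx j j : 'M[K^o]_n) \in @sl_pred K n K^o.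
Proof. by rewrite -(mul_delta_mx j i i) -(mul_delta_mx i j j) sl_comm. Qed.

Lemma coroot_diag (i j : 'I_n) : Sl (coroot_subproof i j) \in cartan_pred.
Proof.
apply/is_diag_mxP => k l kl; rewrite !mxE.
have nkl m : (k == m) && (l == m) = false.
  by apply: contraNF kl => /andP[/eqP-> /eqP->].
by rewrite !nkl subrr.
Qed.

(* E_ii - E_jj *)
Definition coroot (i j : 'I_n) : cartan := Cartan (coroot_diag i j).

(* h^* is {scalar cartan}; integral_weight is membership in the lattice P. *)
Definition integral_weight (mu : {scalar cartan}) : Prop :=
  forall i j : 'I_n, j = i.+1 :> nat -> exists m : int, mu (coroot i j) = m%:~R.

Definition dominant_integral (mu : {scalar cartan}) : Prop :=
  forall i j : 'I_n, j = i.+1 :> nat -> exists m : nat, mu (coroot i j) = m%:R.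

Definition strictly_upper (x : sl n K^o) : Prop :=
  forall i j : 'I_n, (j <= i)%N -> (x : 'M_n) i j = 0.

End Cartan.

Section Weyl.
Variables (K : fieldType) (n : nat) (R : algType K).
Implicit Types (M : lieModule (sl n R)) (mu : {scalar cartan K n}).

Definition weight_vector M mu (v : M) : Prop :=
  forall h : cartan K n, lm_act (sl_tensor h 1) v = mu h *: v.

(* M is the direct sum of its weight spaces M_mu, mu in P, when weight_sum and
   weight_independent both hold.  Weights are compared extensionally (=1). *)
Definition weight_sum M : Prop :=
  forall v : M, exists (r : nat) (mu : 'I_r -> {scalar cartan K n}) (w : 'I_r -> M),
    (forall i, integral_weight (mu i) /\ weight_vector (mu i) (w i)) /\
    v = \sum_i w i.

Definition weight_independent M : Prop :=
  forall (r : nat) (mu : 'I_r -> {scalar cartan K n}) (w : 'I_r -> M),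
    (forall i j, mu i =1 mu j -> i = j) ->
    (forall i, integral_weight (mu i) /\ weight_vector (mu i) (w i)) ->
    \sum_i w i = 0 -> forall i, w i = 0.

Definition finitely_many_weights M : Prop :=
  exists (r : nat) (mu : 'I_r -> {scalar cartan K n}),
    forall nu, integral_weight nu ->
      (exists2 v : M, weight_vector nu v & v <> 0) -> exists i, nu =1 mu i.

Definition integrable M : Prop :=
  [/\ weight_sum M, weight_independent M & finitely_many_weights M].

Variables (eps : {lrmorphism R -> K^o}) (lam : {scalar cartan K n}).

Definition weyl_relations M (v : M) : Prop :=
  (forall (a : R) (h : cartan K n),
     lm_act (sl_tensor h a) v = (lam h * eps a) *: v) /\
  (forall (a : R) (x : sl n K^o),
     strictly_upper x -> lm_act (sl_tensor x a) v = 0).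

Definition weyl_candidate M (v : M) : Prop :=
  [/\ integrable M, generates v & weyl_relations v].

(* The Weyl module is specified by its universal property, which determines
   the pair (W, w) up to a unique isomorphism. *)
Definition is_weyl_module (W : lieModule (sl n R)) (w : W) : Prop :=
  weyl_candidate w /\
  forall M (v : M), weyl_candidate v ->
    exists f : {linear W -> M},
      [/\ lie_equivariant f, f w = v & forall u, exists x, f x = u].

End Weyl.

Section Action.
Variables (K : fieldType) (gT : finGroupType) (A : comAlgType K).

Definition finitely_generated : Prop :=
  exists s : seq A, forall S : A -> Prop,
    [/\ S 1, forall (c : K) a b, S a -> S b -> S (c *: a + b) &
        forall a b, S a -> S b -> S (a * b)] ->
    (forall a, a \in s -> S a) -> forall a, S a.

Record algAction := AlgAction {
  alg_act :> gT -> {lrmorphism A -> A};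
  alg_act1 : forall a, alg_act 1%g a = a;
  alg_actM : forall g h a, alg_act (g * h)%g a = alg_act g (alg_act h a)
}.

End Action.

(* f stands for \sum_g (f g) g; the product of smash_mul extends
   (a g)(b h) = a g(b) gh, see smash_eltM. *)
Definition smash (K : fieldType) (gT : finGroupType) (A : comAlgType K)
  (act : algAction gT A) : Type := {ffun gT -> A}.

Section Smash.
Variables (K : fieldType) (gT : finGroupType) (A : comAlgType K).
Variable act : algAction gT A.

Local Notation smash := (smash act).

HB.instance Definition _ := GRing.Lmodule.copy smash {ffun gT -> A}.

Definition smash_elt (a : A) (g : gT) : smash :=
  [ffun h => if h == g then a else 0].

Definition smash_one : smash := smash_elt 1 1%g.

Definition smash_mul (f f' : smash) : smash :=
  [ffun k => \sum_h f h * act h (f' (h^-1 * k)%g)].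

Fact smash_mulA : associative smash_mul.
Proof.
move=> f1 f2 f3; apply/ffunP=> k; rewrite !ffunE.
under [RHS]eq_bigr => h _ do rewrite ffunE mulr_suml.
rewrite exchange_big /=; apply: eq_bigr => l _.
rewrite ffunE rmorph_sum mulr_sumr (reindex_inj (mulgI l^-1%g)) /=.
apply: eq_bigr => h _; rewrite rmorphM /= -alg_actM mulrA.
by rewrite mulKVg invMg invgK -mulgA mulKVg.
Qed.

Fact smash_mul1l : left_id smash_one smash_mul.
Proof.
move=> f; apply/ffunP=> k; rewrite ffunE (bigD1 1%g) //= big1 => [|h /negPf h1].
  by rewrite ffunE eqxx mul1r invg1 mul1g alg_act1 addr0.
by rewrite ffunE h1 mul0r.
Qed.

Fact smash_mul1r : right_id smash_one smash_mul.
Proof.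
move=> f; apply/ffunP=> k; rewrite ffunE (bigD1 k) //= big1 => [|h hk].
  by rewrite ffunE mulVg eqxx rmorph1 mulr1 addr0.
by rewrite ffunE -eq_mulVg1 (negPf hk) rmorph0 mulr0.
Qed.

Fact smash_mulDl : left_distributive smash_mul +%R.
Proof.
move=> f1 f2 f3; apply/ffunP=> k; rewrite !ffunE -big_split /=.
by apply: eq_bigr => h _; rewrite ffunE mulrDl.
Qed.

Fact smash_mulDr : right_distributive smash_mul +%R.
Proof.
move=> f1 f2 f3; apply/ffunP=> k; rewrite !ffunE -big_split /=.
by apply: eq_bigr => h _; rewrite ffunE rmorphD mulrDr.
Qed.

Fact smash_one_neq0 : smash_one != 0.
Proof.
by apply/eqP=> /ffunP/(_ 1%g); rewrite !ffunE eqxx => /eqP; rewrite oner_eq0.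
Qed.

HB.instance Definition _ := GRing.Zmodule_isNzRing.Build smash
  smash_mulA smash_mul1l smash_mul1r smash_mulDl smash_mulDr smash_one_neq0.

Fact smash_scaleAl (c : K) (f f' : smash) : c *: (f * f') = (c *: f) * f'.
Proof.
apply/ffunP=> k; rewrite !ffunE scaler_sumr.
by apply: eq_bigr => h _; rewrite ffunE scalerAl.
Qed.

HB.instance Definition _ := GRing.Lmodule_isLalgebra.Build K smash smash_scaleAl.

Fact smash_scaleAr (c : K) (f f' : smash) : c *: (f * f') = f * (c *: f').
Proof.
apply/ffunP=> k; rewrite !ffunE scaler_sumr.
by apply: eq_bigr => h _; rewrite ffunE linearZ scalerAr.
Qed.

HB.instance Definition _ := GRing.Lalgebra_isAlgebra.Build K smash smash_scaleAr.

Lemma smash_eltM a b g h :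
  smash_elt a g * smash_elt b h = smash_elt (a * act g b) (g * h)%g.
Proof.
apply/ffunP=> k; rewrite !ffunE (bigD1 g) //= big1 => [|l /negPf lg].
  rewrite !ffunE eqxx addr0 -(inj_eq (mulgI g)) mulKVg.
  by case: ifP => // _; rewrite rmorph0 mulr0.
by rewrite ffunE lg mul0r.
Qed.

Lemma smash_eltZ (c : K) a g : smash_elt (c *: a) g = c *: smash_elt a g.
Proof. by apply/ffunP=> k; rewrite !ffunE; case: ifP; rewrite ?scaler0. Qed.

Lemma smash_eltD a b g : smash_elt (a + b) g = smash_elt a g + smash_elt b g.
Proof. by apply/ffunP=> k; rewrite !ffunE; case: ifP; rewrite ?addr0. Qed.

Lemma smash_elt_sum (f : smash) : f = \sum_g smash_elt (f g) g.
Proof.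
apply/ffunP=> k; rewrite sum_ffunE (bigD1 k) //= big1 => [|h hk].
  by rewrite ffunE eqxx addr0.
by rewrite ffunE eq_sym (negPf hk).
Qed.

End Smash.

Section Complement.
Variables (K : fieldType) (gT : finGroupType) (A : comAlgType K).
Variable act : algAction gT A.

Definition invariant (a : A) : Prop := forall g, act g a = a.

(* A G-stable subspace A' without nonzero invariants with A = A^G (+) A';
   directness of the sum is the absence of invariants. *)
Record noninvariant_complement := NonInvariantComplement {
  compl_pred :> {pred A};
  compl_submod : submod_closed compl_pred;
  compl_stable : forall g a, a \in compl_pred -> act g a \in compl_pred;
  compl_inv0 : forall a, a \in compl_pred -> invariant a -> a = 0;
  compl_sum : forall a, exists b c,
    [/\ invariant b, c \in compl_pred & a = b + c]
}.

Lemma act_sum_invariant a : invariant (\sum_g act g a).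
Proof.
move=> h; rewrite linear_sum [RHS](reindex_inj (mulgI h)) /=.
by apply: eq_bigr => g _; rewrite alg_actM.
Qed.

Lemma compl_act_sum (A' : noninvariant_complement) a :
  a \in (A' : {pred A}) -> \sum_g act g a = 0.
Proof.
move=> aA'; apply: (@compl_inv0 A') (act_sum_invariant a).
have [A0 AP] := compl_submod A'.
elim/big_ind: _ => [//|x y xA yA|g _]; last exact: compl_stable.
by rewrite -[x]scale1r AP.
Qed.

Lemma compl_act_sub (A' : noninvariant_complement) g a :
  act g a - a \in (A' : {pred A}).
Proof.
have [b [c [bI cA ->]]] := compl_sum A' a.
have [A0 AP] := compl_submod A'.
rewrite linearD /= bI addrAC opprD addrA subrr add0r -scaleN1r.
by rewrite AP // compl_stable.
Qed.

End Complement.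

Section ComplementExists.
Variables (K : numFieldType) (gT : finGroupType) (A : comAlgType K).
Variable act : algAction gT A.

Let cardG_neq0 : #|gT|%:R != 0 :> K.
Proof. by rewrite pnatr_eq0 -lt0n; apply/card_gt0P; exists 1%g. Qed.

Lemma complE (A' : noninvariant_complement act) a :
  (a \in (A' : {pred A})) = (\sum_g act g a == 0).
Proof.
apply/idP/eqP => [|a0]; first exact: compl_act_sum.
have [A0 AP] := compl_submod A'.
suff -> : a = - #|gT|%:R^-1 *: \sum_g (act g a - a).
  rewrite -[_ *: _]addr0 AP //; elim/big_ind: _ => [//|x y xA yA|g _].
    by rewrite -[x]scale1r AP.
  exact: compl_act_sub.
rewrite big_split /= a0 add0r sumr_const mulNrn -(scaler_nat _ a).
by rewrite scalerN scaleNr opprK scalerA mulVf ?scale1r.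
Qed.

Lemma noninvariant_complement_exists : inhabited (noninvariant_complement act).
Proof.
have act_sum_lin (c : K) a b :
    \sum_g act g (c *: a + b) = c *: (\sum_g act g a) + \sum_g act g b.
  by rewrite scaler_sumr -big_split; apply: eq_bigr => g _; rewrite linearP.
constructor; exists [pred a | \sum_g act g a == 0].
- split=> [|c a b]; rewrite !inE; first by rewrite big1 // => g _; rewrite linear0.
  by move=> /eqP a0 /eqP b0; rewrite act_sum_lin a0 b0 scaler0 addr0.
- move=> h a; rewrite !inE => /eqP a0; apply/eqP; rewrite -[RHS]a0.
  rewrite [RHS](reindex_inj (mulIg h)) /=.
  by apply: eq_bigr => g _; rewrite alg_actM.
- move=> a; rewrite inE => /eqP a0 aI; move: a0.
  rewrite (eq_bigr (fun=> a)) => [|g _]; last exact: aI.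
  rewrite sumr_const -(scaler_nat _ a) => /eqP.
  by rewrite scaler_eq0 (negPf cardG_neq0) => /eqP.
move=> a; pose b := #|gT|%:R^-1 *: \sum_g act g a.
have bI : invariant act b by move=> g; rewrite linearZ /= act_sum_invariant.
exists b, (a - b); split=> //; last by rewrite addrC subrK.
rewrite inE addrC -scaleN1r act_sum_lin scaleN1r.
rewrite (eq_bigr (fun=> b)) => [|g _]; last exact: bI.
by rewrite sumr_const -(scaler_nat _ b) scalerA mulfV // scale1r addNr.
Qed.

End ComplementExists.

Section IdealGen.
Variables (A : comNzRingType) (S : {pred A}).

Definition gen_ideal : {pred A} := fun x =>
  `[< exists s : seq (A * A),
        (forall p, p \in s -> p.2 \in S) /\ x = \sum_(p <- s) p.1 * p.2 >].

Lemma gen_ideal0 : 0 \in gen_ideal.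
Proof. by apply/asboolP; exists [::]; rewrite big_nil. Qed.

Lemma gen_idealP a x y :
  x \in gen_ideal -> y \in gen_ideal -> a * x + y \in gen_ideal.
Proof.
move=> /asboolP[s [sS ->]] /asboolP[t [tS ->]]; apply/asboolP.
exists ([seq (a * p.1, p.2) | p <- s] ++ t); split.
  move=> p; rewrite mem_cat => /orP[/mapP[q qs ->] /=|]; [exact: sS|exact: tS].
rewrite big_cat big_map mulr_sumr /=; congr (_ + _).
by apply: eq_bigr => p _; rewrite mulrA.
Qed.

Lemma gen_ideal_mem x : x \in S -> x \in gen_ideal.
Proof.
move=> xS; apply/asboolP; exists [:: (1, x)]; split.
  by move=> p; rewrite inE => /eqP ->.
by rewrite big_seq1 mul1r.
Qed.

End IdealGen.

Section QuotientAlgebra.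
Variables (K : fieldType) (A : comAlgType K) (I : idealr A).

Definition quot_alg : Type := {ideal_quot I}.
HB.instance Definition _ := GRing.ComNzRing.on quot_alg.

Definition quot_pi (a : A) : quot_alg := \pi_({ideal_quot I}) a.

Lemma quot_piP (x : quot_alg) : exists a, quot_pi a = x.
Proof. by exists (repr (x : {ideal_quot I})); rewrite /quot_pi reprK. Qed.

Lemma quot_pi_eq a b : quot_pi a = quot_pi b <-> a - b \in (I : {pred A}).
Proof.
split=> [/eqP|ab]; first by rewrite -Quotient.idealrBE.
by apply/eqP; rewrite -Quotient.idealrBE.
Qed.

Lemma quot_piD a b : quot_pi (a + b) = quot_pi a + quot_pi b.
Proof. exact: (rmorphD \pi_({ideal_quot I})). Qed.

Lemma quot_piM a b : quot_pi (a * b) = quot_pi a * quot_pi b.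
Proof. exact: (rmorphM \pi_({ideal_quot I})). Qed.

Lemma quot_pi1 : quot_pi 1 = 1.
Proof. exact: (rmorph1 \pi_({ideal_quot I})). Qed.

Definition quot_scale (c : K) (x : quot_alg) : quot_alg :=
  quot_pi c%:A * x.

Fact quot_scaleA a b x : quot_scale a (quot_scale b x) = quot_scale (a * b) x.
Proof. by rewrite /quot_scale mulrA -quot_piM mulr_algl scalerA. Qed.
Fact quot_scale1 : left_id 1 quot_scale.
Proof. by move=> x; rewrite /quot_scale scale1r quot_pi1 mul1r. Qed.
Fact quot_scaleDr : right_distributive quot_scale +%R.
Proof. by move=> c x y; rewrite /quot_scale mulrDr. Qed.
Fact quot_scaleDl x : {morph quot_scale^~ x : a b / a + b}.
Proof. by move=> a b; rewrite /quot_scale scalerDl quot_piD mulrDl. Qed.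

HB.instance Definition _ := GRing.Zmodule_isLmodule.Build K quot_alg
  quot_scaleA quot_scale1 quot_scaleDr quot_scaleDl.

Fact quot_scaleAl (c : K) (x y : quot_alg) : c *: (x * y) = (c *: x) * y.
Proof. exact: mulrA. Qed.

HB.instance Definition _ := GRing.Lmodule_isLalgebra.Build K quot_alg quot_scaleAl.

Fact quot_scaleAr (c : K) (x y : quot_alg) : c *: (x * y) = x * (c *: y).
Proof. exact: mulrCA. Qed.

HB.instance Definition _ := GRing.Lalgebra_isAlgebra.Build K quot_alg quot_scaleAr.

Lemma quot_piZ (c : K) a : quot_pi (c *: a) = c *: quot_pi a.
Proof. by rewrite -mulr_algl quot_piM. Qed.

End QuotientAlgebra.

Section Abar.
Variables (K : numFieldType) (gT : finGroupType) (A : comAlgType K).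
Variables (act : algAction gT A) (eps : {lrmorphism smash act -> K^o}).
Variable A' : noninvariant_complement act.

Definition eps_alg (a : A) : K := eps (smash_elt act a 1%g).
Definition eps_grp (g : gT) : K := eps (smash_elt act 1 g).

Lemma smash_elt_AG a g :
  smash_elt act a g = smash_elt act a 1%g * smash_elt act 1 g.
Proof. by rewrite smash_eltM rmorph1 mulr1 mul1g. Qed.

Lemma eps_elt a g : eps (smash_elt act a g) = eps_alg a * eps_grp g.
Proof. by rewrite smash_elt_AG rmorphM. Qed.

Lemma eps_alg1 : eps_alg 1 = 1. Proof. exact: rmorph1. Qed.

Lemma eps_algD a b : eps_alg (a + b) = eps_alg a + eps_alg b.
Proof. by rewrite /eps_alg smash_eltD rmorphD. Qed.

Lemma eps_algM a b : eps_alg (a * b) = eps_alg a * eps_alg b.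
Proof. by rewrite /eps_alg -rmorphM smash_eltM alg_act1 mulg1. Qed.

Lemma eps_algZ c a : eps_alg (c *: a) = c * eps_alg a.
Proof. by rewrite /eps_alg smash_eltZ linearZ. Qed.

Lemma eps_grp1 : eps_grp 1%g = 1. Proof. exact: rmorph1. Qed.

Lemma eps_grpM g h : eps_grp (g * h)%g = eps_grp g * eps_grp h.
Proof. by rewrite /eps_grp -rmorphM smash_eltM rmorph1 mulr1. Qed.

Lemma eps_grp_neq0 g : eps_grp g != 0.
Proof.
apply/eqP=> g0; have := eps_grpM g g^-1%g.
by rewrite mulgV eps_grp1 g0 mul0r => /eqP; rewrite oner_eq0.
Qed.

Lemma eps_alg_act g a : eps_alg (act g a) = eps_alg a.
Proof.
apply: (mulIf (eps_grp_neq0 g)); rewrite -eps_elt mulrC -[RHS]rmorphM.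
by rewrite smash_eltM mulg1 mul1r.
Qed.

Lemma eps_alg_compl a : a \in (A' : {pred A}) -> eps_alg a = 0.
Proof.
move=> /compl_act_sum a0.
have epsA0 : eps_alg 0 = 0 by have := eps_algZ 0 0; rewrite scale0r mul0r.
have : eps_alg (\sum_g act g a) = #|gT|%:R * eps_alg a.
  rewrite (big_morph eps_alg eps_algD epsA0) (eq_bigr (fun=> eps_alg a)).
    by rewrite sumr_const mulr_natl.
  by move=> g _; rewrite eps_alg_act.
rewrite a0 epsA0 => /esym/eqP; rewrite mulf_eq0 pnatr_eq0.
by case: eqP => [c0|_ /eqP //]; have := card0_eq c0 1%g.
Qed.

Lemma eps_alg_ideal a : a \in gen_ideal A' -> eps_alg a = 0.
Proof.
have epsA0 : eps_alg 0 = 0 by have := eps_algZ 0 0; rewrite scale0r mul0r.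
move=> /asboolP[s [sA ->]]; rewrite (big_morph eps_alg eps_algD epsA0).
by rewrite big_seq big1 // => p /sA pA; rewrite eps_algM (eps_alg_compl pA) mulr0.
Qed.

Lemma compl_ideal_closed : idealr_closed (gen_ideal A').
Proof.
split; [exact: gen_ideal0 | | by move=> a x y; exact: gen_idealP].
by apply/negP=> /eps_alg_ideal/eqP; rewrite eps_alg1 oner_eq0.
Qed.

(* The ideal of A generated by A'; it is proper because eps vanishes on it. *)
Definition compl_ideal : idealr A :=
  HB.pack_for (idealr A) (gen_ideal A')
    (isIdealr.Build A (gen_ideal A') compl_ideal_closed).

Definition Abar : comAlgType K := quot_alg compl_ideal.

Definition Abar_pi (a : A) : Abar := quot_pi compl_ideal a.

Definition eps_bar_fun (x : Abar) : K^o :=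
  eps_alg (repr (x : {ideal_quot compl_ideal})).

Lemma eps_bar_pi a : eps_bar_fun (Abar_pi a) = eps_alg a.
Proof.
apply/eqP; rewrite /eps_bar_fun -subr_eq0 -mulN1r -eps_algZ -eps_algD scaleN1r.
apply/eqP/eps_alg_ideal; have /quot_pi_eq : 
  quot_pi compl_ideal (repr (Abar_pi a : {ideal_quot compl_ideal})) = Abar_pi a.
  by rewrite /quot_pi reprK.
by [].
Qed.

Fact eps_bar_linear : linear eps_bar_fun.
Proof.
move=> c x y; have [a <-] := quot_piP x; have [b <-] := quot_piP y.
by rewrite -quot_piZ -quot_piD !eps_bar_pi eps_algD eps_algZ.
Qed.

Fact eps_bar_monoid_morphism : monoid_morphism eps_bar_fun.
Proof.
split=> [|x y]; first by rewrite -quot_pi1 eps_bar_pi eps_alg1.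
have [a <-] := quot_piP x; have [b <-] := quot_piP y.
by rewrite -quot_piM !eps_bar_pi eps_algM.
Qed.

HB.instance Definition _ := GRing.isLinear.Build K Abar K^o *:%R eps_bar_fun
  eps_bar_linear.
HB.instance Definition _ := GRing.isMonoidMorphism.Build Abar K^o eps_bar_fun
  eps_bar_monoid_morphism.

Definition eps_bar : {lrmorphism Abar -> K^o} := eps_bar_fun.

Lemma Abar_pi_act g a : Abar_pi (act g a) = Abar_pi a.
Proof. by apply/quot_pi_eq; apply/gen_ideal_mem/compl_act_sub. Qed.

Definition smash_to_Abar_fun (f : smash act) : Abar :=
  \sum_g eps_grp g *: Abar_pi (f g).

Fact smash_to_Abar_linear : linear smash_to_Abar_fun.
Proof.
move=> c f f'; rewrite /smash_to_Abar_fun scaler_sumr -big_split.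
apply: eq_bigr => g _ /=; rewrite !ffunE /Abar_pi quot_piD quot_piZ scalerDr.
by rewrite !scalerA mulrC.
Qed.

HB.instance Definition _ := GRing.isLinear.Build K (smash act) Abar *:%R
  smash_to_Abar_fun smash_to_Abar_linear.

Lemma smash_to_Abar_elt a g :
  smash_to_Abar_fun (smash_elt act a g) = eps_grp g *: Abar_pi a.
Proof.
rewrite /smash_to_Abar_fun (bigD1 g) //= big1 => [|h /negPf hg].
  by rewrite ffunE eqxx addr0.
by rewrite ffunE hg -(scale0r (0 : A)) /Abar_pi quot_piZ scale0r scaler0.
Qed.

Fact smash_to_Abar_monoid_morphism : monoid_morphism smash_to_Abar_fun.
Proof.
split=> [|f f'].
  by rewrite smash_to_Abar_elt eps_grp1 scale1r; exact: quot_pi1.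
rewrite [f]smash_elt_sum [f']smash_elt_sum mulr_suml !linear_sum mulr_suml.
apply: eq_bigr => g _; rewrite mulr_sumr linear_sum mulr_sumr.
apply: eq_bigr => h _; rewrite /= smash_eltM !smash_to_Abar_elt eps_grpM.
rewrite {1}/Abar_pi quot_piM -/(Abar_pi _) -/(Abar_pi (act _ _)) Abar_pi_act.
by rewrite -scalerAl -scalerAr scalerA.
Qed.

HB.instance Definition _ := GRing.isMonoidMorphism.Build (smash act) Abar
  smash_to_Abar_fun smash_to_Abar_monoid_morphism.

Definition smash_to_Abar : {lrmorphism smash act -> Abar} := smash_to_Abar_fun.

End Abar.

(* Main.v *)
Require Import Defs.
From HB Require Import structures.
From mathcomp Require Import all_boot all_order all_algebra all_fingroup.
From mathcomp Require Import complex boolp reals.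
From mathcomp Require Import ring.

Set Implicit Arguments.
Unset Strict Implicit.
Unset Printing Implicit Defensive.

Import GRing.Theory Num.Theory.

Local Open Scope ring_scope.

(** Write R = A x| G, let pi : R -> Abar be the map a g |-> eps(g) abar, and let
    J be its kernel.  The theorem holds because the kernel of the map from
    sl_n(R) to sl_n(Abar) must act by zero on the Weyl module over R: that
    module is then one over sl_n(Abar), so each of the two Weyl modules maps onto the other by its universal property, and the two
    maps are inverse to each other because they are on generators
    ([weyl_module_change]).

    Let e = |G|^-1 sum_g eps(g)^-1 g be the idempotent of C[G] attached to the
    character eps of G, and p = 1 - e.  Then eps(p) = 0.  Since g e = eps(g) e,
    every g is congruent to eps(g) modulo the two-sided ideal R p R; and
    e a e = avg(a) e, where avg is the average over G, so that every a in A',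
    having zero average, lies in R p R.  Hence J = R p R
    ([ker_smash_to_Abar] is the inclusion that matters).  The same formula
    gives e R e = A^G e, which is commutative.

    Now let w be a highest weight vector of weight (lam, eps).

    - E_ij (x) p, E_ji (x) p and (E_ii - E_jj) (x) p span a copy of sl_2,
      because p is idempotent, for which w has highest weight 0, because
      eps(p) = 0.  As E_ji (x) p lowers weights, of which there are finitely
      many, it acts nilpotently on w; so it kills w
      ([kills_lowering_idem]).
    - The annihilator of w is a Lie subalgebra.  Bracketing E_ji (x) p with
      (E_ii - E_jj) (x) r for eps(r) = 0 gives all of E_ji (x) J
      ([kills_lowering_gen]).
    - The upper triangular part of the kernel of sl_n(R) -> sl_n(Abar) and the
      matrices (E_ii - E_jj) (x) J kill w by the defining relations.  Modulo all
      these, the kernel lies in E_11 (x) [R, R].  As R = J + e R e with e R e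
      commutative, [R, R] = [R, J], and E_11 (x) [R, J] is reached by brackets
      of E_12 (x) R with E_21 (x) J ([kills_diag_comm]). *)

(** * Linearity of the action *)

Section LinearAction.
Variables (K : fieldType) (L : lieAlgType K) (M : lieModule L).
Implicit Types (x y : L) (u v : M).

Lemma lm_act0l v : lm_act 0 v = 0.
Proof.
have := lm_act_linearl v (-1) 0 0.
by rewrite scaler0 addr0 scaleN1r addNr.
Qed.

Lemma lm_act0r x : lm_act x (0 : M) = 0.
Proof.
have := lm_act_linearr x (-1) (0 : M) 0.
by rewrite scaler0 addr0 scaleN1r addNr.
Qed.

Lemma lm_actDl v : {morph (fun x => lm_act x v) : x y / x + y}.
Proof. by move=> x y; have := lm_act_linearl v 1 x y; rewrite !scale1r. Qed.

Lemma lm_actZl c x v : lm_act (c *: x) v = c *: lm_act x v.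
Proof. by have := lm_act_linearl v c x 0; rewrite lm_act0l !addr0. Qed.

Lemma lm_actZr c x v : lm_act x (c *: v) = c *: lm_act x v.
Proof. by have := lm_act_linearr x c v 0; rewrite lm_act0r !addr0. Qed.

Lemma lm_act_comm x y v :
  lm_act x (lm_act y v) = lm_act (lie x y) v + lm_act y (lm_act x v).
Proof. by rewrite lm_act_lie subrK. Qed.

End LinearAction.

(** * Matrix units in sl_n(R) *)

Section MatrixUnits.
Variables (n : nat) (R : pzRingType).

Definition emx (i j : 'I_n) (a : R) : 'M[R]_n := a *: delta_mx i j.

Lemma emxE i j a k l : emx i j a k l = a *+ ((k == i) && (l == j)).
Proof. by rewrite !mxE mulr_natr. Qed.

Lemma emxD i j : {morph emx i j : a b / a + b}.
Proof. by move=> a b; rewrite /emx scalerDl. Qed.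

Lemma emxN i j a : emx i j (- a) = - emx i j a.
Proof. by rewrite /emx scaleNr. Qed.

Lemma emxB i j : {morph emx i j : a b / a - b}.
Proof. by move=> a b; rewrite emxD emxN. Qed.

Lemma emx0 i j : emx i j 0 = 0.
Proof. by rewrite /emx scale0r. Qed.

Lemma emx_sum i j (I : Type) (s : seq I) (P : pred I) (F : I -> R) :
  emx i j (\sum_(k <- s | P k) F k) = \sum_(k <- s | P k) emx i j (F k).
Proof. exact: (big_morph _ (@emxD i j) (@emx0 i j)). Qed.

Lemma emxM i j k l a b :
  emx i j a *m emx k l b = if j == k then emx i l (a * b) else 0.
Proof.
apply/matrixP=> s t; rewrite mxE (bigD1 j) //= big1 => [|m /negPf mj].
  rewrite addr0 !emxE eqxx andbT; case: (j == k); rewrite ?emxE ?mxE ?mulr0 //.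
  by case: (s == i); case: (t == l); rewrite ?mulr0 ?mul0r.
by rewrite !emxE mj andbF mulr0n mul0r.
Qed.

Lemma matrix_sum_emx (X : 'M[R]_n) : X = \sum_i \sum_j emx i j (X i j).
Proof. by rewrite {1}[X]matrix_sum_delta. Qed.

End MatrixUnits.

Section SlElements.
Variables (K : fieldType) (n : nat) (R : algType K).

Lemma sl_unit_subproof (i j : 'I_n) : i != j ->
  (delta_mx i j : 'M[K^o]_n) \in @sl_pred K n K^o.
Proof.
move=> ij; have := @sl_comm K n K^o (delta_mx i i) (delta_mx i j).
by rewrite mul_delta_mx mul_delta_mx_cond eq_sym (negPf ij) subr0.
Qed.

Lemma sl_val_lie (x y : sl n R) : sl_val (lie x y) = x *m y - y *m x.
Proof. by []. Qed.

Lemma sl_val_scale (c : K) (x : sl n R) : sl_val (c *: x) = (c%:A : R) *: (x : 'M_n).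
Proof. by []. Qed.

Definition sl_unit (i j : 'I_n) (ij : i != j) : sl n K^o := Sl (sl_unit_subproof ij).

Lemma sl_tensor_unit (i j : 'I_n) (ij : i != j) (a : R) :
  (sl_tensor (sl_unit ij) a : 'M_n) = emx i j a.
Proof.
apply/matrixP=> k l; rewrite !mxE.
by case: (_ && _); rewrite ?scale1r ?mulr1 ?scale0r ?mulr0.
Qed.

Lemma sl_tensor_coroot (i j : 'I_n) (a : R) :
  (sl_tensor (coroot K i j) a : 'M_n) = emx i i a - emx j j a.
Proof.
apply/matrixP=> k l; rewrite !mxE scalerBl.
by congr (_ - _); case: (_ && _); rewrite ?scale1r ?mulr1 ?scale0r ?mulr0.
Qed.

Lemma strictly_upper_unit (i j : 'I_n) (ij : i != j) :
  (i < j)%N -> strictly_upper (sl_unit ij).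
Proof.
move=> lij k l lk; rewrite mxE.
case: (altP (k =P i)) lk => // ->; case: (altP (l =P j)) => // -> ji.
by rewrite leqNgt lij in ji.
Qed.

End SlElements.

(** * The annihilator of a vector *)

Section Kills.
Variables (K : fieldType) (n : nat) (R : algType K).
Variables (M : lieModule (sl n R)) (v : M).
Implicit Types X Y : 'M[R]_n.

(** Stated on matrices rather than on elements of sl_n(R), so that brackets can
    be computed with matrix units without carrying membership proofs. *)
Definition kills X : Prop := exists2 x : sl n R, (x : 'M_n) = X & lm_act x v = 0.

Lemma killsP (x : sl n R) : kills x <-> lm_act x v = 0.
Proof. by split=> [[y /val_inj ->]|x0]; [|exists x]. Qed.

Lemma kills0 : kills 0.
Proof. by exists 0; rewrite ?lm_act0l. Qed.

Lemma killsD X Y : kills X -> kills Y -> kills (X + Y).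
Proof.
by move=> [x <- x0] [y <- y0]; exists (x + y); rewrite // lm_actDl x0 y0 addr0.
Qed.

Lemma killsZ (c : K) X : kills X -> kills ((c%:A : R) *: X).
Proof.
by move=> [x <- x0]; exists (c *: x); rewrite // lm_actZl x0 scaler0.
Qed.

Lemma killsN X : kills X -> kills (- X).
Proof. by move/(killsZ (-1)); rewrite scaleN1r scaleN1r. Qed.

Lemma killsB X Y : kills X -> kills Y -> kills (X - Y).
Proof. by move=> kX /killsN; exact: killsD. Qed.

Lemma kills_sum I (r : seq I) (P : pred I) (F : I -> 'M[R]_n) :
  (forall i, P i -> kills (F i)) -> kills (\sum_(i <- r | P i) F i).
Proof. by apply: big_ind; [exact: kills0|exact: killsD]. Qed.

Lemma kills_comm X Y : kills X -> kills Y -> kills (X *m Y - Y *m X).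
Proof.
move=> [x <- x0] [y <- y0]; exists (lie x y) => //.
by rewrite lm_act_lie x0 y0 !lm_act0r subrr.
Qed.

End Kills.

(** * Weights and local nilpotency of root vectors *)

Section Weights.
Variables (K : numFieldType) (n : nat).
Implicit Types mu nu : {scalar cartan K n}.

Definition weight_shift mu nu (k : nat) (h : cartan K n) : K := mu h + k%:R * nu h.

Fact weight_shift_linear mu nu k : linear_for *%R (weight_shift mu nu k).
Proof. by move=> c x y; rewrite /weight_shift !linearP /=; ring. Qed.

HB.instance Definition _ mu nu k := GRing.isLinear.Build K (cartan K n) K *%R
  (weight_shift mu nu k) (weight_shift_linear mu nu k).

Lemma integral_weight_shift mu nu k :
  integral_weight mu -> integral_weight nu ->
  integral_weight (weight_shift mu nu k).
Proof.
move=> muP nuP i j ij; have [a aE] := muP i j ij; have [b bE] := nuP i j ij.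
by exists (a + k%:Z * b); rewrite /= /weight_shift aE bE rmorphD rmorphM.
Qed.

Definition root_fun (i j : 'I_n) (h : cartan K n) : K :=
  (h : 'M[K^o]_n) i i - (h : 'M[K^o]_n) j j.

Fact root_fun_linear i j : linear_for *%R (root_fun i j).
Proof.
by move=> c x y; rewrite /root_fun /= !mxE /= mulr_algl /GRing.scale /=; ring.
Qed.

HB.instance Definition _ i j := GRing.isLinear.Build K (cartan K n) K *%R
  (root_fun i j) (root_fun_linear i j).

Lemma integral_root i j : integral_weight (root_fun i j).
Proof.
move=> k l _; rewrite /= /root_fun !mxE !andbb.
exists ((i == k)%:Z - (i == l)%:Z - ((j == k)%:Z - (j == l)%:Z)).
by rewrite !rmorphB.
Qed.

Lemma root_coroot i j : i != j -> root_fun i j (coroot K i j) = 2.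
Proof.
move=> /negPf ij; rewrite /root_fun !mxE !eqxx /= ij eq_sym ij /=.
by rewrite !subr0 sub0r opprK.
Qed.

Variables (R : algType K) (M : lieModule (sl n R)).
Implicit Type v : M.

Lemma weight_vector_iter mu nu (y : sl n R) v (k : nat) :
  (forall h : cartan K n, lie (sl_tensor h 1) y = nu h *: y) ->
  weight_vector mu v ->
  weight_vector (weight_shift mu nu k) (iter k (lm_act y) v).
Proof.
move=> yP vP h; elim: k => [|k IHk].
  by rewrite vP /= /weight_shift mul0r addr0.
rewrite iterS lm_act_comm yP lm_actZl IHk lm_actZr -scalerDl.
by congr (_ *: _); rewrite /= /weight_shift -natr1; ring.
Qed.

(** The vectors y^k v have pairwise distinct weights mu + k nu, and only
    finitely many weights occur. *)
Lemma root_vector_nilpotent mu nu (y : sl n R) v (h0 : cartan K n) :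
  finitely_many_weights M -> integral_weight mu -> integral_weight nu ->
  nu h0 != 0 ->
  (forall h : cartan K n, lie (sl_tensor h 1) y = nu h *: y) ->
  weight_vector mu v -> exists k, iter k (lm_act y) v = 0.
Proof.
move=> [r [wt wtP]] muP nuP nu0 yP vP; apply: contrapT => nz.
have /choice[f fP] : forall k : 'I_r.+1, exists i, weight_shift mu nu k =1 wt i.
  move=> k; apply: (wtP (weight_shift mu nu k)); first exact: integral_weight_shift.
  exists (iter k (lm_act y) v); first exact: weight_vector_iter.
  by move=> k0; apply: nz; exists k.
have /leq_card : injective f.
  move=> k l fkl; apply/val_inj/eqP; rewrite -(eqr_nat K); apply/eqP.
  apply: (mulIf nu0); apply: (addrI (mu h0)).
  by rewrite -!/(weight_shift _ _ _ _) !fP fkl.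
by rewrite !card_ord ltnn.
Qed.

End Weights.

Section Sl2.
Variables (K : numFieldType) (L : lieAlgType K) (M : lieModule L).

(** In weight 0 one has x y^(k+1) v = - (k+1) k y^k v, so that y^(k+1) v = 0
    forces y^k v = 0 as long as k > 0. *)
Lemma sl2_trivial_weight (x y h : L) (v : M) (k : nat) :
  lie x y = h -> lie h y = -2 *: y ->
  lm_act x v = 0 -> lm_act h v = 0 -> iter k (lm_act y) v = 0 -> lm_act y v = 0.
Proof.
move=> xy hy x0 h0.
have hk m : lm_act h (iter m (lm_act y) v) = (-2 * m%:R) *: iter m (lm_act y) v.
  elim: m => [|m IHm]; first by rewrite h0 mulr0 scale0r.
  rewrite iterS lm_act_comm hy lm_actZl IHm lm_actZr -scalerDl.
  by congr (_ *: _); rewrite -natr1; ring.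
have xk m : lm_act x (iter m.+1 (lm_act y) v)
    = - (m.+1%:R * m%:R) *: iter m (lm_act y) v.
  elim: m => [|m IHm].
    by rewrite /= lm_act_comm xy h0 x0 lm_act0r addr0 mulr0 oppr0 scale0r.
  rewrite iterS lm_act_comm xy hk IHm lm_actZr -scalerDl.
  by congr (_ *: _); rewrite -!natr1; ring.
elim: k => [/= ->|[//|k] IHk k0]; first by rewrite lm_act0r.
apply: IHk; move: (xk k.+1); rewrite k0 lm_act0r => /esym/eqP.
by rewrite scaler_eq0 oppr_eq0 mulf_eq0 !pnatr_eq0 => /eqP.
Qed.

End Sl2.

(** * The two-sided ideal generated by an element *)

Section IdempotentIdeal.
Variables (R : pzRingType) (p : R).

Definition in_ideal (r : R) : Prop :=
  exists s : seq (R * R), r = \sum_(q <- s) q.1 * p * q.2.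

Lemma in_ideal_gen a b : in_ideal (a * p * b).
Proof. by exists [:: (a, b)]; rewrite big_seq1. Qed.

Lemma in_ideal0 : in_ideal 0.
Proof. by exists [::]; rewrite big_nil. Qed.

Lemma in_idealD r s : in_ideal r -> in_ideal s -> in_ideal (r + s).
Proof. by move=> [a ->] [b ->]; exists (a ++ b); rewrite big_cat. Qed.

Lemma in_idealMl a r : in_ideal r -> in_ideal (a * r).
Proof.
move=> [s ->]; exists [seq (a * q.1, q.2) | q <- s].
by rewrite big_map mulr_sumr; apply: eq_bigr => q _; rewrite !mulrA.
Qed.

Lemma in_idealMr a r : in_ideal r -> in_ideal (r * a).
Proof.
move=> [s ->]; exists [seq (q.1, q.2 * a) | q <- s].
by rewrite big_map mulr_suml; apply: eq_bigr => q _; rewrite !mulrA.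
Qed.

Lemma in_ideal_sum I (s : seq I) (P : pred I) (F : I -> R) :
  (forall i, P i -> in_ideal (F i)) -> in_ideal (\sum_(i <- s | P i) F i).
Proof. by apply: big_ind; [exact: in_ideal0|exact: in_idealD]. Qed.

Lemma in_ideal_idem : in_ideal p.
Proof. by rewrite -[p]mulr1 -[p]mul1r; exact: in_ideal_gen. Qed.

End IdempotentIdeal.

(** * Annihilation of a highest weight vector by the ideal of an idempotent *)

Section HighestWeight.
Variables (K : numFieldType) (n : nat) (R : algType K).
Variables (eps : {lrmorphism R -> K^o}) (lam : {scalar cartan K n}).
Variables (M : lieModule (sl n R)) (w : M) (p : R).
Hypotheses (lamP : integral_weight lam) (wP : weyl_candidate eps lam w).
Hypotheses (pp : p * p = p) (eps_p : eps p = 0).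

Let kw := kills w.

Lemma kills_raising (i j : 'I_n) (a : R) : (i < j)%N -> kw (emx i j a).
Proof.
move=> ij; have nij : i != j by rewrite neq_ltn ij.
rewrite -(sl_tensor_unit nij); apply/killsP.
by case: wP => _ _ [_]; apply; exact: strictly_upper_unit.
Qed.

Lemma kills_coroot (i j : 'I_n) (a : R) : eps a = 0 -> kw (emx i i a - emx j j a).
Proof.
move=> a0; rewrite -sl_tensor_coroot; apply/killsP.
by case: wP => _ _ [-> _]; rewrite a0 mulr0 scale0r.
Qed.

Lemma lie_cartan_unit (i j : 'I_n) (ij : i != j) (a : R) (h : cartan K n) :
  lie (sl_tensor h 1) (sl_tensor (sl_unit K ij) a)
    = root_fun i j h *: sl_tensor (sl_unit K ij) a.
Proof.
apply: val_inj => /=.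
have -> : map_mx (fun c : K => c *: (1 : R)) (h : 'M_n)
    = diag_mx (\row_k ((h : 'M_n) k k)%:A).
  apply/matrixP=> k l; rewrite !mxE; case: (altP (k =P l)) => [->|kl] //.
  by have /is_diag_mxP -> := valP h; rewrite ?scale0r.
rewrite mul_diag_mx mul_mx_diag; apply/matrixP=> k l; rewrite !mxE.
case: (altP (k =P i)) => [->|]; case: (altP (l =P j)) => [->|] /=;
  rewrite ?scale0r ?mulr0 ?mul0r ?subrr //.
by rewrite scale1r !mulr_algl mulr_algr scalerBl.
Qed.

(** For the sl_2 spanned by E_ij (x) p, E_ji (x) p and their bracket, w is a
    highest weight vector of weight lam(E_ii - E_jj) eps(p) = 0. *)
Lemma kills_lowering_idem (i j : 'I_n) : (i < j)%N -> kw (emx j i p).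
Proof.
move=> ij; have nij : i != j by rewrite neq_ltn ij.
have nji : j != i by rewrite eq_sym.
pose x := sl_tensor (sl_unit K nij) p; pose y := sl_tensor (sl_unit K nji) p.
pose h := sl_tensor (coroot K i j) p.
rewrite -(sl_tensor_unit nji); apply/killsP.
have [[_ _ fin] _ [wh wx]] := wP.
have [k yk] : exists k, iter k (lm_act y) w = 0.
  have [h0 nz_h0] : exists h0, root_fun j i h0 != 0 :> K.
    by exists (coroot K j i); rewrite root_coroot // pnatr_eq0.
  apply: (@root_vector_nilpotent _ _ _ _ lam (root_fun j i) y w h0) => //.
  - exact: integral_root.
  - exact: lie_cartan_unit.
  by move=> g; rewrite wh rmorph1 mulr1.
apply: (@sl2_trivial_weight _ _ _ x y h w k) => //.
- apply: val_inj; rewrite [LHS]sl_val_lie /x /y [RHS]sl_tensor_coroot.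
  rewrite !sl_tensor_unit !emxM.
  by rewrite !eqxx pp.
- apply: val_inj; rewrite [LHS]sl_val_lie [RHS]sl_val_scale /y.
  rewrite sl_tensor_unit sl_tensor_coroot.
  rewrite mulmxBl mulmxBr !emxM !eqxx (negPf nij) pp sub0r subr0.
  by rewrite scaleNr scaleNr -opprD -mulr2n !scaler_nat.
- by apply: wx; exact: strictly_upper_unit.
by rewrite wh eps_p mulr0 scale0r.
Qed.

(** The bracket of (E_ii - E_jj) (x) r with E_ji (x) s is
    - E_ji (x) (r s + s r). *)
Lemma kills_lowering_anticomm (i j : 'I_n) (r s : R) : i != j ->
  eps r = 0 -> kw (emx j i s) -> kw (emx j i (r * s + s * r)).
Proof.
move=> /[dup] nij; rewrite eq_sym => nji r0 /(kills_comm (kills_coroot i j r0)).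
rewrite mulmxBl mulmxBr !emxM !eqxx (negPf nij) sub0r subr0.
by rewrite -opprD -emxD => /killsN; rewrite opprK.
Qed.

Let kills_half (i j : 'I_n) (a : R) : kw (emx i j (a + a)) -> kw (emx i j a).
Proof.
move=> /(killsZ 2^-1); rewrite /emx scalerA -mulr2n -scaler_nat mulr_algl scalerA.
by rewrite mulVf ?scale1r // pnatr_eq0.
Qed.

(** Anticommutators r s + s r with eps(r) = 0 are all that the Cartan part
    provides; since p is idempotent in the kernel of eps, they produce first
    p a p, then p a and a p, and last r p s = (r p)(p s). *)
Lemma kills_lowering_gen (i j : 'I_n) (r s : R) : (i < j)%N ->
  kw (emx j i (r * p * s)).
Proof.
move=> ij; have nij : i != j by rewrite neq_ltn ij.
have eps_l a : eps (p * a) = 0 by rewrite rmorphM /= eps_p mul0r.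
have eps_r a : eps (a * p) = 0 by rewrite rmorphM /= eps_p mulr0.
have anti := kills_lowering_anticomm nij.
have kp := kills_lowering_idem ij.
have kpap a : kw (emx j i (p * a * p)).
  apply: kills_half; have := anti _ _ (eps_r (p * a)) kp.
  by rewrite -!mulrA pp !mulrA pp.
have kpa a : kw (emx j i (p * a)).
  (* (p a) p + p (p a) = p a p + p a *)
  have := killsB (anti _ _ (eps_l a) kp) (kpap a).
  by rewrite -emxB [p * (p * a)]mulrA pp [_ + p * a]addrC addrK.
have kap a : kw (emx j i (a * p)).
  have := killsB (anti _ _ (eps_r a) kp) (kpap a).
  by rewrite -emxB -[a * p * p]mulrA pp [p * (a * p)]mulrA addrK.
(* (r p)(p s) + (p s)(r p) = r p s + (p s r) p *)
have := killsB (anti _ _ (eps_r r) (kpa s)) (kap (p * s * r)).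
by rewrite -emxB !mulrA addrK -[r * p * p]mulrA pp.
Qed.

Lemma kills_offdiag (i j : 'I_n) (a : R) : i != j -> in_ideal p a -> kw (emx i j a).
Proof.
rewrite neq_ltn => /orP[ij _|ji [s ->]]; first exact: kills_raising.
rewrite /emx scaler_suml; apply: kills_sum => q _.
exact: kills_lowering_gen.
Qed.

Lemma eps_ideal (a : R) : in_ideal p a -> eps a = 0.
Proof.
move=> [s ->]; rewrite rmorph_sum big1 // => q _.
by rewrite !rmorphM /= eps_p mulr0 mul0r.
Qed.

(** [E_ij (x) a, E_ji (x) b] = E_ii (x) [a, b] + (E_ii - E_jj) (x) b a. *)
Lemma kills_diag_comm_ideal (i j : 'I_n) (a b : R) : (i < j)%N -> in_ideal p b ->
  kw (emx i i (a * b - b * a)).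
Proof.
move=> ij bJ; have nji : j != i by rewrite neq_ltn ij orbT.
have kba : kw (emx i i (b * a) - emx j j (b * a)).
  by apply: kills_coroot; apply: eps_ideal; exact: in_idealMr.
have := killsB (kills_comm (kills_raising a ij) (kills_offdiag nji bJ)) kba.
by rewrite !emxM !eqxx opprB addrA subrK -emxB.
Qed.

Let q := 1 - p.

Hypothesis corner_comm : forall a b,
  (q * a * q) * (q * b * q) = (q * b * q) * (q * a * q).

(** Peirce decomposition: only the corner q R q is not in R p R. *)
Lemma sub_corner_ideal a : in_ideal p (a - q * a * q).
Proof.
have -> : a - q * a * q = 1 * p * a + q * a * p * 1.
  rewrite mul1r mulr1 -{1}[a]mul1r -{1}(subrK p 1) -/q mulrDl.
  rewrite -{1}[q * a]mulr1 -{1}(subrK p 1) -/q mulrDr.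
  by rewrite addrAC [X in X - _]addrC addrK addrC.
by apply: in_idealD; exact: in_ideal_gen.
Qed.

(** Modulo R p R both a and b lie in the corner q R q, where they commute; so
    [a, b] is a sum of commutators having one entry in R p R. *)
Lemma kills_diag_comm (i j : 'I_n) (a b : R) : (i < j)%N ->
  kw (emx i i (a * b - b * a)).
Proof.
move=> ij; have kJ c d := @kills_diag_comm_ideal i j c d ij.
have commDr c d d' : c * (d + d') - (d + d') * c
    = (c * d - d * c) + (c * d' - d' * c).
  by rewrite mulrDl mulrDr opprD addrACA.
rewrite -(subrK (q * b * q) b) commDr emxD; apply: killsD.
  exact/kJ/sub_corner_ideal.
rewrite -opprB -(subrK (q * a * q) a) commDr corner_comm subrr addr0 emxN.
exact/killsN/kJ/sub_corner_ideal.
Qed.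

Hypothesis n_ge2 : (2 <= n)%N.

(** A matrix in sl_n(R) has its trace in [R, R]; this is what controls its
    diagonal once the matrices (E_ii - E_oo) (x) a are split off. *)
Lemma kills_sl_ideal (x : sl n R) :
  (forall i j, in_ideal p ((x : 'M_n) i j)) -> lm_act x w = 0.
Proof.
move=> xJ; apply/killsP.
have o_lt : (0 < n)%N by exact: ltnW.
pose o : 'I_n := Ordinal o_lt; pose o' : 'I_n := Ordinal n_ge2.
have -> : (x : 'M_n) = (\sum_i \sum_(j | j != i) emx i j ((x : 'M_n) i j)
    + \sum_i (emx i i ((x : 'M_n) i i) - emx o o ((x : 'M_n) i i)))
    + emx o o (\tr (x : 'M_n)).
  rewrite sumrB /mxtrace emx_sum addrA subrK -big_split.
  rewrite {1}[LHS]matrix_sum_emx; apply: eq_bigr => i _.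
  by rewrite (bigD1 i) //= addrC.
apply: killsD; first apply: killsD.
- apply: kills_sum => i _; apply: kills_sum => j ji.
  by apply: kills_offdiag; rewrite // eq_sym.
- by apply: kills_sum => i _; apply: kills_coroot; exact: eps_ideal.
have /asboolP[s ->] := sl_valP x.
rewrite raddf_sum emx_sum; apply: kills_sum => -[X Y] _ /=.
have -> : \tr (X *m Y - Y *m X) = \sum_i \sum_j (X i j * Y j i - Y j i * X i j).
  have trE (P Q : 'M[R]_n) : \tr (P *m Q) = \sum_i \sum_j P i j * Q j i.
    by apply: eq_bigr => i _; rewrite mxE.
  rewrite raddfB /= !trE [X in _ - X]exchange_big -sumrB; apply: eq_bigr => i _.
  by rewrite -sumrB.
rewrite emx_sum; apply: kills_sum => i _.
rewrite emx_sum; apply: kills_sum => j _.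
exact: (@kills_diag_comm o o').
Qed.

End HighestWeight.

(** * Change of rings for Weyl modules *)

Section Descent.
Variables (K : fieldType) (n : nat) (R S : algType K) (phi : {lrmorphism R -> S}).

Lemma sl_map_surj : (forall s, exists r, phi r = s) ->
  forall y : sl n S, exists x : sl n R, sl_map phi x = y.
Proof.
move=> /choice[sec secK] [y yP].
have /asboolP[s yE] := yP.
pose lift (Y : 'M[S]_n) : 'M[R]_n := map_mx sec Y.
have liftK Y : map_mx phi (lift Y) = Y.
  by apply/matrixP=> i j; rewrite !mxE secK.
have xP : \sum_(q <- s) (lift q.1 *m lift q.2 - lift q.2 *m lift q.1)
    \in @sl_pred K n R.
  by apply: rpred_sum => q _; exact: sl_comm.
exists (Sl xP); apply: val_inj; rewrite /= yE raddf_sum; apply: eq_bigr => q _.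
by rewrite /= map_mxB !map_mxM !liftK.
Qed.

Lemma sl_map_tensor (x : sl n K^o) (a : R) :
  sl_map phi (sl_tensor x a) = sl_tensor x (phi a).
Proof. by apply/val_inj/matrixP=> i j; rewrite !mxE linearZ. Qed.

(** An arbitrary set-theoretic section suffices to define the action of
    sl_n(S): once the kernel acts by zero, the action of a lift depends only on
    the element lifted. *)
Variables (lift : sl n S -> sl n R) (M : lieModule (sl n R)).
Hypothesis liftK : cancel lift (sl_map phi).
Hypothesis ker_act : forall x, sl_map phi x = 0 -> forall v : M, lm_act x v = 0.

Lemma act_sl_map_eq (x y : sl n R) (v : M) :
  sl_map phi x = sl_map phi y -> lm_act x v = lm_act y v.
Proof.
move=> xy; have : lm_act (-1 *: y + x) v = 0.
  by apply: ker_act; rewrite sl_map_linear xy scaleN1r addNr.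
by rewrite lm_act_linearl scaleN1r addrC => /eqP; rewrite subr_eq0 => /eqP.
Qed.

Definition descent_act (y : sl n S) (v : M) : M := lm_act (lift y) v.

Lemma descent_actE (x : sl n R) (v : M) :
  descent_act (sl_map phi x) v = lm_act x v.
Proof. by apply: act_sl_map_eq; rewrite liftK. Qed.

Fact descent_act_linearl (v : M) : linear (descent_act^~ v).
Proof.
move=> c x y; rewrite -(liftK x) -(liftK y) -sl_map_linear !descent_actE.
exact: lm_act_linearl.
Qed.

Fact descent_act_linearr y : linear (descent_act y).
Proof. exact: lm_act_linearr. Qed.

Fact descent_act_lie x y (v : M) :
  descent_act (lie x y) v
    = descent_act x (descent_act y v) - descent_act y (descent_act x v).
Proof.
rewrite -(liftK x) -(liftK y) -sl_map_lie !descent_actE.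
exact: lm_act_lie.
Qed.

Definition descent : lieModule (sl n S) :=
  LieModule descent_act_linearl descent_act_linearr descent_act_lie.

End Descent.

Section ChangeOfRings.
Variables (K : fieldType) (n : nat) (R S : algType K) (phi : {lrmorphism R -> S}).
Hypothesis phi_surj : forall s, exists r, phi r = s.
Variables (epsR : {lrmorphism R -> K^o}) (epsS : {lrmorphism S -> K^o}).
Hypothesis eps_phi : forall r, epsS (phi r) = epsR r.
Variable lam : {scalar cartan K n}.

(** The vectors killed by an ideal of the Lie algebra form a submodule. *)
Lemma ker_act_generated (M : lieModule (sl n R)) (w : M) :
  generates w -> (forall x, sl_map phi x = 0 -> lm_act x w = 0) ->
  forall x, sl_map phi x = 0 -> forall v : M, lm_act x v = 0.
Proof.
move=> gen_w ker_w x x0 v; move: v x x0.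
apply: (gen_w (fun v => forall x, sl_map phi x = 0 -> lm_act x v = 0)) => //.
split=> [x _|c u v u0 v0 x x0|y u u0 x x0]; first exact: lm_act0r.
  by rewrite lm_act_linearr u0 // v0 // scaler0 addr0.
rewrite lm_act_comm u0 ?u0 ?lm_act0r ?addr0 //.
by rewrite sl_map_lie x0; apply: val_inj; rewrite /= mul0mx mulmx0 subrr.
Qed.

(** The two modules share their carrier, and h (x) 1 acts in the same way on
    both; so the two have the same weight vectors and submodules. *)
Lemma weyl_candidate_change (M : lieModule (sl n R)) (a : sl n S -> M -> M)
    (al : forall v, linear (a^~ v)) (ar : forall x, linear (a x))
    (alie : forall x y v, a (lie x y) v = a x (a y v) - a y (a x v)) (v : M) :
  (forall x u, a (sl_map phi x) u = lm_act x u) ->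
  weyl_candidate epsR lam v <->
  @weyl_candidate K n S epsS lam (LieModule al ar alie) v.
Proof.
move=> aE; pose N := LieModule al ar alie.
have atE (h : sl n K^o) r u : lm_act (sl_tensor h r) u = a (sl_tensor h (phi r)) u.
  by rewrite -sl_map_tensor aE.
have wvE : @weight_vector K n R M = @weight_vector K n S N.
  apply/funext=> mu; apply/funext=> u; apply/propext.
  by rewrite /weight_vector; split=> uP h; have := uP h; rewrite atE rmorph1.
have intE : integrable M = integrable N.
  by rewrite /integrable /weight_sum /weight_independent /finitely_many_weights wvE.
have subE (T : M -> Prop) : lie_submodule T <-> @lie_submodule K (sl n S) N T.
  split=> -[T0 TP Ta]; split=> // x u Tu; last by rewrite -aE; exact: Ta.
  by have [y <-] := sl_map_surj phi_surj x; rewrite /= aE; exact: Ta.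
have genE : generates v <-> @generates K (sl n S) N v.
  by split=> gv T /subE; exact: gv.
have relE : weyl_relations epsR lam v <-> @weyl_relations K n S epsS lam N v.
  split=> -[hP uP]; split=> r h.
  - by have [s <-] := phi_surj r; rewrite /= -atE hP eps_phi.
  - by have [s <-] := phi_surj r; move=> /(uP s); rewrite /= -atE.
  - by rewrite atE -eps_phi; exact: hP.
  by rewrite atE; exact: uP.
by rewrite /weyl_candidate intE; split=> -[? /genE ? /relE].
Qed.

Lemma weyl_candidate_restrict (N : lieModule (sl n S)) (v : N) :
  weyl_candidate epsS lam v ->
  @weyl_candidate K n R epsR lam (sl_restrict phi N) v.
Proof.
case: N v => V a al ar alie v.
pose M := sl_restrict phi (LieModule al ar alie).
exact: (@weyl_candidate_change M a al ar alie v (fun _ _ => erefl)).2.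
Qed.

(** The composites of the two maps given by the universal properties fix the
    generators, hence are identities. *)
Lemma weyl_module_change (W : lieModule (sl n R)) (w : W)
    (Wbar : lieModule (sl n S)) (wbar : Wbar) :
  (forall x, sl_map phi x = 0 -> lm_act x w = 0) ->
  is_weyl_module epsR lam w -> is_weyl_module epsS lam wbar ->
  lie_isomorphic W (sl_restrict phi Wbar).
Proof.
move=> ker_w [candW univW] [candWbar univWbar].
have [_ gen_w _] := candW; have [_ gen_wbar _] := candWbar.
have ker_W := ker_act_generated gen_w ker_w.
have /choice[lift liftK] := sl_map_surj (n := n) phi_surj.
have dE := descent_actE liftK ker_W.
have [g [geq gw _]] := univWbar (descent liftK ker_W) w
  ((weyl_candidate_change _ _ _ _ dE).1 candW).
have [f [feq fw _]] := univW _ _ (weyl_candidate_restrict candWbar).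
exists f; split=> //; exists g.
  apply: (gen_w (fun u => g (f u) = u)); last by rewrite fw.
  split=> [|c u u' uK uK'|x u uK]; first by rewrite !linear0.
    by rewrite !linearP /= uK uK'.
  by rewrite feq /= geq /= dE uK.
apply: (gen_wbar (fun u => f (g u) = u)); last by rewrite gw.
split=> [|c u u' uK uK'|y u uK]; first by rewrite !linear0.
  by rewrite !linearP /= uK uK'.
by have [x <-] := sl_map_surj phi_surj y; rewrite geq /= dE feq uK.
Qed.

End ChangeOfRings.

(** * The idempotent of a smash product attached to its augmentation *)

Section SmashIdempotent.
Variables (K : numFieldType) (gT : finGroupType) (A : comAlgType K).
Variables (act : algAction gT A) (eps : {lrmorphism smash act -> K^o}).

Local Notation ofG g := (smash_elt act 1 g).
Local Notation ofA a := (smash_elt act a 1%g).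
Local Notation cardG := (#|gT|%:R : K).

Let cardG_neq0 : cardG != 0.
Proof. by rewrite pnatr_eq0 -lt0n; apply/card_gt0P; exists 1%g. Qed.

Lemma smash_elt0l : ofA 0 = 0.
Proof. by apply/ffunP=> k; rewrite !ffunE; case: ifP. Qed.

Lemma smash_elt_suml (I : Type) (s : seq I) (P : pred I) (F : I -> A) :
  ofA (\sum_(i <- s | P i) F i) = \sum_(i <- s | P i) ofA (F i).
Proof.
exact: (big_morph (fun a => ofA a) (fun a b => smash_eltD act a b 1%g) smash_elt0l).
Qed.

(** The central idempotent of the group algebra for the character eps of G. *)
Definition eps_idem : smash act := cardG^-1 *: \sum_g (eps_grp eps g)^-1 *: ofG g.

Lemma ofGM g h : ofG (g * h)%g = ofG g * ofG h.
Proof. by rewrite smash_eltM rmorph1 mulr1. Qed.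

Lemma ofG_ofA g a : ofG g * ofA a = ofA (act g a) * ofG g.
Proof. by rewrite !smash_eltM mul1r mulg1 mul1g rmorph1 mulr1. Qed.

Lemma ofG_eps_idem g : ofG g * eps_idem = eps_grp eps g *: eps_idem.
Proof.
rewrite /eps_idem -scalerAr scalerA mulrC -scalerA mulr_sumr; congr (_ *: _).
rewrite scaler_sumr [RHS](reindex_inj (mulgI g)) /=; apply: eq_bigr => h _.
rewrite -scalerAr -ofGM eps_grpM scalerA invfM mulrA mulfV ?mul1r //.
exact: eps_grp_neq0.
Qed.

Lemma eps_idemE (x : smash act) :
  eps_idem * x = cardG^-1 *: \sum_g (eps_grp eps g)^-1 *: (ofG g * x).
Proof.
rewrite /eps_idem -scalerAl mulr_suml; congr (_ *: _).
by apply: eq_bigr => g _; rewrite scalerAl.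
Qed.

Lemma avg_const (V : lmodType K) (v : V) (f : gT -> V) :
  (forall g, f g = v) -> cardG^-1 *: \sum_g f g = v.
Proof.
move=> fv; rewrite (eq_bigr (fun=> v)) // sumr_const -(scaler_nat _ v) scalerA.
by rewrite mulVf ?scale1r.
Qed.

Lemma eps_idem_idem : eps_idem * eps_idem = eps_idem.
Proof.
rewrite eps_idemE; apply: avg_const => g.
by rewrite ofG_eps_idem scalerA mulVf ?scale1r ?eps_grp_neq0.
Qed.

Lemma eps_eps_idem : eps eps_idem = 1.
Proof.
rewrite linearZ /= linear_sum /=; apply: (avg_const (V := K^o)) => g.
by rewrite linearZ /=; apply: mulVf; exact: eps_grp_neq0.
Qed.

(** Moving g past a in e = |G|^-1 sum eps(g)^-1 g turns a into g(a), and the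
    remaining g is absorbed by e. *)
Lemma eps_idem_ofA a :
  eps_idem * ofA a * eps_idem = ofA (cardG^-1 *: \sum_g act g a) * eps_idem.
Proof.
rewrite -mulrA eps_idemE smash_eltZ -scalerAl; congr (_ *: _).
rewrite smash_elt_suml mulr_suml; apply: eq_bigr => g _.
rewrite mulrA ofG_ofA -mulrA ofG_eps_idem -scalerAr scalerA.
by rewrite mulVf ?scale1r // eps_grp_neq0.
Qed.

Lemma invariantZ c b : Defs.invariant act b -> Defs.invariant act (c *: b).
Proof. by move=> bI g; rewrite linearZ /= bI. Qed.

Lemma eps_idem_corner (x : smash act) :
  exists2 b, Defs.invariant act b & eps_idem * x * eps_idem = ofA b * eps_idem.
Proof.
rewrite {1}(smash_elt_sum x) mulr_sumr mulr_suml.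
elim/big_ind: _ => [|y z [b bI ->] [c cI ->]|g _].
- by exists 0; [move=> g; rewrite linear0 | rewrite smash_elt0l mul0r].
- exists (b + c); first by move=> g; rewrite linearD /= bI cI.
  by rewrite smash_eltD mulrDl.
exists (eps_grp eps g *: (cardG^-1 *: \sum_h act h (x g))).
  by apply/invariantZ/invariantZ; exact: act_sum_invariant.
rewrite smash_elt_AG -!mulrA ofG_eps_idem -2!scalerAr mulrA eps_idem_ofA.
by rewrite [in RHS]smash_eltZ -scalerAl.
Qed.

Lemma invariant_comm_idem b : Defs.invariant act b ->
  ofA b * eps_idem = eps_idem * ofA b.
Proof.
move=> bI; rewrite /eps_idem -scalerAl -scalerAr mulr_suml mulr_sumr.
by congr (_ *: _); apply: eq_bigr => g _; rewrite -scalerAl -scalerAr ofG_ofA bI.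
Qed.

(** The corner is A^G e, and A^G is commutative and commutes with e. *)
Lemma eps_idem_corner_comm (x y : smash act) :
  (eps_idem * x * eps_idem) * (eps_idem * y * eps_idem)
    = (eps_idem * y * eps_idem) * (eps_idem * x * eps_idem).
Proof.
have [b bI ->] := eps_idem_corner x; have [c cI ->] := eps_idem_corner y.
have mulE d d' : Defs.invariant act d' ->
    ofA d * eps_idem * (ofA d' * eps_idem) = ofA (d * d') * eps_idem.
  move=> /invariant_comm_idem d'E; rewrite d'E -mulrA [eps_idem * _]mulrA.
  rewrite eps_idem_idem -d'E mulrA smash_eltM alg_act1 mulg1 //.
by rewrite !mulE // mulrC.
Qed.

Variable A' : noninvariant_complement act.

(** Modulo the ideal generated by 1 - e, each g becomes the scalar eps(g), and
    each a in A' vanishes since e a e = avg(a) e = 0.  So an element sum a_g g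
    becomes sum eps(g) a_g, which is in the ideal generated by A' when its
    image in Abar is zero. *)
Lemma ker_smash_to_Abar (x : smash act) :
  smash_to_Abar eps A' x = 0 -> in_ideal (1 - eps_idem) x.
Proof.
set p := 1 - eps_idem => x0.
have ofG_J g : in_ideal p (ofG g - (eps_grp eps g)%:A).
  have -> : ofG g - (eps_grp eps g)%:A = (ofG g - (eps_grp eps g)%:A) * p.
    by rewrite mulrBr mulr1 mulrBl ofG_eps_idem mulr_algl subrr subr0.
  exact/in_idealMl/in_ideal_idem.
have compl_J a : a \in (A' : {pred A}) -> in_ideal p (ofA a).
  move=> /compl_act_sum a0; have := sub_corner_ideal p (ofA a).
  by rewrite /p subKr eps_idem_ofA a0 scaler0 smash_elt0l mul0r subr0.
have gen_J a : a \in gen_ideal A' -> in_ideal p (ofA a).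
  move=> /asboolP[s [sA ->]]; rewrite smash_elt_suml big_seq.
  apply: in_ideal_sum => q qs.
  have -> : ofA (q.1 * q.2) = ofA q.1 * ofA q.2 by rewrite smash_eltM alg_act1 mulg1.
  by apply/in_idealMl/compl_J/sA.
pose b := \sum_g eps_grp eps g *: x g.
have bJ : b \in gen_ideal A'.
  have /quot_pi_eq : Abar_pi eps A' b = Abar_pi eps A' 0.
    have pi0 : Abar_pi eps A' 0 = 0.
      by rewrite -(scale0r 0) /Abar_pi quot_piZ scale0r.
    rewrite pi0 -[RHS]x0 (big_morph (Abar_pi eps A') (quot_piD _) pi0).
    by apply: eq_bigr => g _; exact: quot_piZ.
  by rewrite subr0.
rewrite -[x](subrK (ofA b)); apply: in_idealD (gen_J _ bJ).
rewrite {1}(smash_elt_sum x) smash_elt_suml -sumrB; apply: in_ideal_sum => g _.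
rewrite smash_elt_AG smash_eltZ -[_ *: _](mulr_algr) -mulrBr.
exact/in_idealMl/ofG_J.
Qed.

Lemma eps_bar_smash (x : smash act) :
  eps_bar eps A' (smash_to_Abar eps A' x) = eps x.
Proof.
rewrite [in RHS](smash_elt_sum x) !linear_sum; apply: eq_bigr => g _.
by rewrite linearZ /= eps_bar_pi eps_elt mulrC.
Qed.

End SmashIdempotent.

Theorem theorem5p7 (R : realType) (n : nat) (A : comAlgType R[i])
    (gT : finGroupType) (act : algAction gT A)
    (eps : {lrmorphism smash act -> R[i]^o})
    (A' : noninvariant_complement act)
    (lam : {scalar cartan R[i] n})
    (W : lieModule (sl n (smash act))) (w : W)
    (Wbar : lieModule (sl n (Abar eps A'))) (wbar : Wbar) :
  (2 <= n)%N ->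
  finitely_generated A ->
  dominant_integral lam ->
  is_weyl_module eps lam w ->
  is_weyl_module (eps_bar eps A') lam wbar ->
  lie_isomorphic W (sl_restrict (smash_to_Abar eps A') Wbar).
Proof.
move=> n_ge2 _ lam_dom Ww Wbarw.
have lamP : integral_weight lam.
  by move=> i j ij; have [m ->] := lam_dom i j ij; exists m.
have ee := eps_idem_idem eps; pose p := 1 - eps_idem eps.
have pp : p * p = p by rewrite /p mulrBl mul1r mulrBr mulr1 ee subrr subr0.
have eps_p : eps p = 0 by rewrite rmorphB rmorph1 /= eps_eps_idem subrr.
apply: (weyl_module_change _ _ _ Ww Wbarw).
- move=> x; have [a <-] := quot_piP x; exists (smash_elt act a 1%g).
  by rewrite /= smash_to_Abar_elt eps_grp1 scale1r.
- exact: eps_bar_smash.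
move=> x x0; apply: (kills_sl_ideal lamP Ww.1 pp eps_p) => // [a b|i j].
  by rewrite /p subKr eps_idem_corner_comm.
apply: (@ker_smash_to_Abar _ _ _ _ _ A').
have /matrixP/(_ i j) := congr1 (@sl_val _ _ _) x0.
by rewrite !mxE.
Qed.
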